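(* Let $k\ge2$, let $\mathcal{C}$ be a (nondegenerate) $[\mathbf{n},k]_{q^m/q}$ sum-rank metric code with $\mathbf{n}=(n_1,\ldots,n_t)$, $N=n_1+\cdots+n_t$, and let $(U_1,\ldots,U_t)$ be an associated system. Assume that $U_1\cap\cdots\cap U_t$ does not contain any $1$-dimensional $\mathbb{F}_{q^m}$-subspace of $\mathbb{F}_{q^m}^k$. Then $\mathcal{C}$ is a one-weight code if and only if $\mathcal{C}^{\perp_{\mathcal{G}}}$ is one-weight with respect to the generalized weights of order $k-1$, that is, \[ d_{k-1}(\mathcal{C}^{\perp_{\mathcal{G}}})=tmk-N-\sum_{i=1}^t\dim_{\mathbb{F}_q}\bigl(U_i^{\perp'}\cap\langle w\rangle_{\mathbb{F}_{q^m}}\bigr) \] for every $w\in\mathbb{F}_{q^m}^k\setminus\{0\}$. In particular, if $\mathcal{C}$ is one-weight and $d_1(\mathcal{C})\neq tm$, then \[ \bigcup_{i=1}^tL_{U_i^{\perp'}}=\mathrm{PG}(k-1,q^m). \]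
   Context: Let $q$ be a prime power and $\mathbf{n}=(n_1,\ldots,n_t)$, $\mathbb{F}_{q^m}^{\mathbf{n}}=\bigoplus_{i=1}^t\mathbb{F}_{q^m}^{n_i}$ (order of block lengths is immaterial here). The rank of $v\in\mathbb{F}_{q^m}^n$ is the $\mathbb{F}_q$-dimension of the $\mathbb{F}_q$-span of its entries; the sum-rank weight of $x=(x_1,\ldots,x_t)$ is $w(x)=\sum_i\mathrm{rk}(x_i)$. An $[\mathbf{n},k]_{q^m/q}$ code is a $k$-dimensional $\mathbb{F}_{q^m}$-subspace of $\mathbb{F}_{q^m}^{\mathbf{n}}$ with distance $w(x-y)$; it is one-weight if all nonzero codewords have the same sum-rank weight. A generator matrix is $G=(G_1|\cdots|G_t)$ with $G_i\in\mathbb{F}_{q^m}^{k\times n_i}$ and rows a basis of the code; the code is nondegenerate if the columns of each $G_i$ are $\mathbb{F}_q$-independent. All codes are assumed nondegenerate. Systems: an $[\mathbf{n},k]_{q^m/q}$-system is an ordered tuple $(U_1,\ldots,U_t)$ of $\mathbb{F}_q$-subspaces of $\mathbb{F}_{q^m}^k$ with $\dim_{\mathbb{F}_q}U_i=n_i$ and $\langle U_1,\ldots,U_t\rangle_{\mathbb{F}_{q^m}}=\mathbb{F}_{q^m}^k$. If $G=(G_1|\cdots|G_t)$ generates $\mathcal{C}$ and $U_i$ is the $\mathbb{F}_q$-span of the columns of $G_i$, then $(U_1,\ldots,U_t)$ is a system associated with $\mathcal{C}$. Conversely, a code associated with a system is one generated by $(G_1|\cdots|G_t)$ where the columns of $G_i$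 form an $\mathbb{F}_q$-basis of $U_i$. Geometric dual: fix a nondegenerate reflexive sesquilinear form $\sigma$ on $V=\mathbb{F}_{q^m}^k$ and let $\sigma'(x,y)=\mathrm{Tr}_{q^m/q}(\sigma(x,y))$, regarded as a nondegenerate reflexive sesquilinear form on $V$ seen as a $km$-dimensional $\mathbb{F}_q$-space. For an $\mathbb{F}_q$-subspace $U$ of $V$ let $U^{\perp'}$ be its orthogonal complement with respect to $\sigma'$, of $\mathbb{F}_q$-dimension $km-\dim_{\mathbb{F}_q}U$. If $U_1\cap\cdots\cap U_t$ contains no $1$-dimensional $\mathbb{F}_{q^m}$-subspace, the geometric dual $\mathcal{C}^{\perp_{\mathcal{G}}}$ is any code associated with the system $(U_1^{\perp'},\ldots,U_t^{\perp'})$; it has total length $tmk-N$. Generalized weights: for a code with associated system $(V_1,\ldots,V_t)$ and total length $M$, and $r\in\{1,\ldots,k\}$, $d_r=M-\max_H\sum_{i=1}^t\dim_{\mathbb{F}_q}(V_i\cap H)$, with $H$ over $\mathbb{F}_{q^m}$-subspaces of $\mathbb{F}_{q^m}^k$ of codimension $r$. Linear sets: for an $\mathbb{F}_q$-subspace $U$ of $\mathbb{F}_{q^m}^k$, $L_U=\{\langle u\rangle_{\mathbb{F}_{q^m}}:u\in U\setminus\{0\}\}\subseteq\mathrm{PG}(k-1,q^m)$. *)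

(* Defs.v *)
From HB Require Import structures.
From mathcomp Require Import all_boot all_order all_algebra all_field.
From mathcomp Require Import boolp classical_sets.

Set Implicit Arguments.
Unset Strict Implicit.
Unset Printing Implicit Defensive.

Import GRing.Theory.
Local Open Scope ring_scope.

(* An L-space V seen as an F-space by restriction of scalars.  The carrier is  *)
(* V itself: F-subspaces have type {vspace rscal V}, L-subspaces {vspace V}.   *)
Definition rscal (F : fieldType) (L : fieldExtType F) (V : vectType L) :
  predArgType := V.

Section RestrictionOfScalars.
Context (F : fieldType) (L : fieldExtType F) (V : vectType L).
Implicit Types (a b : F) (u v : rscal V).

HB.instance Definition _ := GRing.Zmodule.on (rscal V).

Definition rscale a v : rscal V := a%:A *: (v : V).

Fact rscaleA a b v : rscale a (rscale b v) = rscale (a * b) v.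
Proof. by rewrite /rscale scalerA -scalerAl mul1r scalerA. Qed.

Fact rscale1 : left_id 1 rscale.
Proof. by move=> v; rewrite /rscale !scale1r. Qed.

Fact rscaleDr : right_distributive rscale +%R.
Proof. by move=> a u v; rewrite /rscale scalerDr. Qed.

Fact rscaleDl v : {morph rscale^~ v : a b / a + b}.
Proof. by move=> a b; rewrite /rscale !scalerDl. Qed.

HB.instance Definition _ := GRing.Zmodule_isLmodule.Build F (rscal V)
  rscaleA rscale1 rscaleDr rscaleDl.

Lemma rscaleE a v : a *: v = a%:A *: (v : V) :> V.
Proof. by []. Qed.

Fact rscal_vect_iso : Vector.axiom (\dim {:V} * \dim {:L}) (rscal V).
Proof.
pose f v := mxvec (\matrix_(i < \dim {:V}, j < \dim {:L})
  coord (vbasis {:L}) j (coord (vbasis {:V}) i (v : V))).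
have f_lin : linear f.
  move=> a u v; rewrite /f -linearP; congr mxvec; apply/matrixP=> i j.
  rewrite !mxE -linearP -mulr_algl; congr (coord _ j _).
  exact: (linearP (coord (vbasis {:V}) i) a%:A u v).
exists f => //.
exists (fun x => \sum_i
  (\sum_j vec_mx x i j *: (vbasis {:L})`_j) *: (vbasis {:V})`_i : V) => [v|x].
  rewrite /f mxvecK [RHS](coord_vbasis (memvf (v : V))); apply: eq_bigr => i _.
  congr (_ *: _); rewrite [RHS](coord_vbasis (memvf _)).
  by apply: eq_bigr => j _; rewrite mxE.
apply: (canLR vec_mxK); apply/matrixP=> i j; rewrite mxE.
by rewrite !coord_sum_free // (basis_free (vbasisP _)).
Qed.

HB.instance Definition _ := Lmodule_hasFinDim.Build F (rscal V) rscal_vect_iso.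

Definition rspace (H : {vspace V}) : {vspace rscal V} :=
  <<([seq b *: h | b : L <- vbasis {:L}, h : V <- vbasis H] : seq (rscal V))>>%VS.

Lemma mem_rspace (H : {vspace V}) (v : V) :
  ((v : rscal V) \in rspace H) = (v \in H).
Proof.
apply/idP/idP=> [|vH].
  move=> /(coord_span (X := in_tuple _))->.
  apply: (big_ind (fun x : rscal V => (x : V) \in H)) => [|x y|i _].
  - exact: mem0v.
  - exact: memvD.
  have /allpairsP[[b h] /= [_ hH ->]] := mem_nth 0 (ltn_ord i).
  by rewrite rscaleE !memvZ // vbasis_mem.
rewrite (coord_vbasis vH).
apply: (big_ind (fun x : V => (x : rscal V) \in rspace H)) => [|x y|i _].
- exact: mem0v.
- exact: memvD.
rewrite [X in X *: _](coord_vbasis (memvf _)) scaler_suml.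
apply: (big_ind (fun x : V => (x : rscal V) \in rspace H)) => [|x y|j _].
- exact: mem0v.
- exact: memvD.
rewrite -mulr_algl -scalerA -rscaleE memvZ // memv_span //.
by apply: allpairs_f; rewrite mem_nth ?size_tuple.
Qed.

End RestrictionOfScalars.

Section SumRankCodes.
Context (F : finFieldType) (L : fieldExtType F).

Definition rk a (x : 'rV[L]_a) : nat := \dim <<[seq x 0%R j | j : 'I_a]>>%VS.

Definition columns k a (A : 'M[L]_(k, a)) : seq (rscal 'cV[L]_k) :=
  [seq col j A | j : 'I_a].

Definition generator_matrix k a (C : {vspace 'rV[L]_a}) (G : 'M[L]_(k, a)) :=
  basis_of C [seq row i G | i : 'I_k].

Section Blocks.
Context (t : nat) (n : 'I_t -> nat).
Implicit Types (C : {vspace 'rV[L]_(\sum_(i < t) n i)}).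

(* A word x = (x_1, ..., x_t) is the concatenation of its blocks submxrow x i. *)
Definition sumrank_weight (x : 'rV[L]_(\sum_(i < t) n i)) : nat :=
  (\sum_(i < t) rk (submxrow x i))%N.

Definition one_weight C : Prop :=
  {in C &, forall x y, x != 0 -> y != 0 -> sumrank_weight x = sumrank_weight y}.

Definition nondegenerate_code C : Prop :=
  exists2 G : 'M[L]_(\dim C, \sum_(i < t) n i),
    generator_matrix C G & forall i, free (columns (submxrow G i)).

Definition associated_system k C (U : 'I_t -> {vspace rscal 'cV[L]_k}) : Prop :=
  exists2 G : 'M[L]_(k, \sum_(i < t) n i),
    generator_matrix C G & forall i, U i = <<columns (submxrow G i)>>%VS.

Definition associated_code k (U : 'I_t -> {vspace rscal 'cV[L]_k}) C : Prop :=
  exists2 G : 'M[L]_(k, \sum_(i < t) n i),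
    generator_matrix C G & forall i, basis_of (U i) (columns (submxrow G i)).

(* The values d are bounded by M, so the maximum over all H is the largest     *)
(* attained value d < M.+1.                                                    *)
Definition system_gen_weight k (U : 'I_t -> {vspace rscal 'cV[L]_k})
    (M r : nat) : nat :=
  (M - \max_(d < M.+1 | `[< exists2 H : {vspace 'cV[L]_k}, \dim H + r = k
         & \sum_(i < t) \dim (U i :&: rspace H) = d >]) d)%N.

Definition canonical_generator a (C : {vspace 'rV[L]_a}) : 'M[L]_(\dim C, a) :=
  \matrix_(i < \dim C) (vbasis C)`_i.

(* Independent of the generator matrix chosen, by gen_weightE.                 *)
Definition gen_weight C (r : nat) : nat :=
  system_gen_weight (fun i => <<columns (submxrow (canonical_generator C) i)>>%VS)
    (\sum_(i < t) n i) r.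

Lemma canonical_generatorP a (C : {vspace 'rV[L]_a}) :
  generator_matrix C (canonical_generator C).
Proof.
rewrite /generator_matrix.
have -> : [seq row i (canonical_generator C) | i : 'I_(\dim C)] = vbasis C.
  apply: (@eq_from_nth _ 0) => [|i]; rewrite size_map size_enum_ord ?size_tuple //.
  move=> ltik; rewrite (nth_map (Ordinal ltik)) ?size_enum_ord // rowK.
  by rewrite nth_enum_ord.
exact: vbasisP.
Qed.

Lemma generator_basis k a (C : {vspace 'rV[L]_a}) (G : 'M[L]_(k, a)) :
  generator_matrix C G -> basis_of C (mktuple (fun i => row i G)).
Proof. by []. Qed.

Lemma generator_dim k a (C : {vspace 'rV[L]_a}) (G : 'M[L]_(k, a)) :
  generator_matrix C G -> \dim C = k.
Proof. by move=> /generator_basis/size_basis. Qed.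

Lemma generator_change k a (C : {vspace 'rV[L]_a}) (G G' : 'M[L]_(k, a)) :
  generator_matrix C G -> generator_matrix C G' ->
  exists2 A : 'M[L]_k, A \in unitmx & G' = A *m G.
Proof.
have half (X Y : 'M[L]_(k, a)) : generator_matrix C X -> generator_matrix C Y ->
    exists A : 'M[L]_k, Y = A *m X.
  move=> /generator_basis bX /generator_basis bY.
  exists (\matrix_(i, j) coord (mktuple (fun i => row i X)) j (row i Y)).
  apply/row_matrixP=> i; have Yi : row i Y \in C.
    by rewrite -(nth_mktuple (fun i => row i Y) 0) (basis_mem bY) ?mem_nth ?size_tuple.
  rewrite {1}(coord_basis bX Yi) row_mul mulmx_sum_row.
  by apply: eq_bigr => j _; rewrite !mxE nth_mktuple.
move=> bG bG'; have [A defG'] := half _ _ bG bG'; have [B defG] := half _ _ bG' bG.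
exists A => //.
have free0 (v : 'rV_k) : v *m G = 0 -> v = 0.
  rewrite mulmx_sum_row => v0; have /freeP fG := basis_free (generator_basis bG).
  apply/rowP=> i; rewrite mxE; apply: (fG (v 0)).
  by rewrite -[RHS]v0; apply: eq_bigr => j _; rewrite nth_mktuple.
suff /mulmx1_unit[] : B *m A = 1%:M by [].
apply/subr0_eq/row_matrixP=> i; rewrite row0; apply: free0.
by rewrite -row_mul mulmxBl -mulmxA -defG' -defG mul1mx subrr row0.
Qed.

Lemma columns_mul k (A : 'M[L]_k) (H : {vspace 'cV[L]_k}) :
  A \in unitmx -> exists2 H' : {vspace 'cV[L]_k}, \dim H' = \dim H &
    forall a (X : 'M[L]_(k, a)), \dim (<<columns (A *m X)>> :&: rspace H') =
                                 \dim (<<columns X>> :&: rspace H).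
Proof.
move=> Au; pose fL := linfun (mulmx A : 'cV[L]_k -> 'cV[L]_k).
have fF_lin : linear (mulmx A : rscal 'cV[L]_k -> rscal 'cV[L]_k).
  by move=> a u v; rewrite rscaleE mulmxDr -scalemxAr -rscaleE.
pose fF_isL := GRing.isLinear.Build F (rscal 'cV[L]_k) (rscal 'cV[L]_k) _ _ fF_lin.
pose fF0 : {linear rscal 'cV[L]_k -> rscal 'cV[L]_k} :=
  HB.pack (mulmx A : rscal 'cV[L]_k -> rscal 'cV[L]_k) fF_isL.
pose fF := linfun fF0.
have fLE v : fL v = A *m v by rewrite lfunE.
have fFE v : fF v = A *m v by rewrite lfunE.
have fLker : lker fL = 0%VS.
  by apply/eqP/lker0P=> u v; rewrite !fLE => /(can_inj (mulKmx Au)).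
have fFker : lker fF = 0%VS.
  by apply/eqP/lker0P=> u v; rewrite !fFE => /(can_inj (mulKmx Au)).
exists (fL @: H)%VS => [|a X]; first by rewrite limg_dim_eq // fLker capv0.
rewrite -[RHS](@limg_dim_eq _ _ _ fF) ?fFker ?capv0 //; congr (\dim _).
have -> : <<columns (A *m X)>>%VS = (fF @: <<columns X>>)%VS.
  rewrite limg_span -map_comp; congr span; apply: eq_map => j /=.
  by rewrite fFE -[RHS]/(A *m col j X) !colE mulmxA.
apply/vspaceP=> v; apply/idP/memv_imgP.
  rewrite memv_cap => /andP[/memv_imgP[u uX ->]]; rewrite fFE mem_rspace => /memv_imgP[w wH].
  rewrite fLE => /(can_inj (mulKmx Au)) uw; exists u; rewrite ?fFE //.
  by rewrite memv_cap uX mem_rspace uw.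
case=> u; rewrite !memv_cap => /andP[uX uH] ->; rewrite memv_img //=.
by rewrite fFE mem_rspace -fLE memv_img // -mem_rspace.
Qed.

Lemma gen_weightE k C (U : 'I_t -> {vspace rscal 'cV[L]_k}) r :
  associated_system C U ->
  gen_weight C r = system_gen_weight U (\sum_(i < t) n i) r.
Proof.
case=> G bG defU; rewrite /gen_weight.
have := canonical_generatorP C; move: (canonical_generator C).
rewrite (generator_dim bG) => G' bG'.
have [A Au defG'] := generator_change bG bG'.
have [B Bu defG] := generator_change bG' bG.
rewrite /system_gen_weight; congr subn; apply: eq_bigl => d; apply: asbool_equiv_eq.
split=> -[H dimH <-].
  have [H' dimH' capH'] := columns_mul H Bu.
  exists H'; rewrite ?dimH' //; apply: eq_bigr => i _.
  by rewrite defU defG -mul_submxrow capH'.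
have [H' dimH' capH'] := columns_mul H Au.
exists H'; rewrite ?dimH' //; apply: eq_bigr => i _.
by rewrite defU defG' -mul_submxrow capH'.
Qed.

End Blocks.

(* The relative trace Tr_{L/F}, as the sum of the Frobenius conjugates, in L.  *)
Definition trace (x : L) : L := \sum_(i < \dim {:L}) x ^+ (#|F| ^ i).

Lemma expf_cardX (c : F) i : c ^+ (#|F| ^ i) = c.
Proof. by elim: i => // i IHi; rewrite expnSr exprM IHi expf_card. Qed.

Fact trace_linear : linear trace.
Proof.
have [p _ pF] := finPcharP F.
have pL : p \in [pchar L] by rewrite pchar_lalg.
have natF i : [pchar L].-nat (#|F| ^ i)%N.
  rewrite pnatX; apply/orP; left; rewrite (eq_pnat _ (pcharf_eq pL)) -cardsT.
  exact/abelian.abelem_pgroup/abelian.fin_ring_pchar_abelem.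
move=> a x y; rewrite /trace scaler_sumr -big_split; apply: eq_bigr => i _ /=.
by rewrite exprDn_pchar // exprZn expf_cardX.
Qed.

HB.instance Definition _ :=
  GRing.isLinear.Build F L L _ trace trace_linear.

Section Forms.
Context (k : nat) (theta : {rmorphism L -> L}).
Implicit Type sigma : {bilinear 'cV[L]_k -> 'cV[L]_k -> L | *%R & theta \; *%R}.

Definition nondegenerate_form sigma : Prop :=
  forall x, (forall y, sigma x y = 0) -> x = 0.

Definition reflexive_form sigma : Prop :=
  forall x y, sigma x y = 0 -> sigma y x = 0.

(* The orthogonal complement of U for the form (x, y) |-> trace (sigma x y).   *)
(* Orthogonality is tested on an F-basis of U, see mem_orthTr; x is on the     *)
(* left because sigma is only theta-semilinear on the right.                   *)
Definition orthTr sigma (U : {vspace rscal 'cV[L]_k}) :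
    {vspace rscal 'cV[L]_k} :=
  (\bigcap_(u <- vbasis U)
     lker (linfun (fun x : rscal 'cV[L]_k => trace (sigma x u))))%VS.

Lemma mem_orthTr sigma (U : {vspace rscal 'cV[L]_k}) (x : rscal 'cV[L]_k) :
  reflect (forall u : rscal 'cV[L]_k, u \in U -> trace (sigma x u) = 0)
          (x \in orthTr sigma U).
Proof.
have lE (u : 'cV[L]_k) (y : rscal 'cV[L]_k) :
    linfun (fun x : rscal 'cV[L]_k => trace (sigma x u)) y = trace (sigma y u).
  pose f (x : rscal 'cV[L]_k) := trace (sigma x u).
  have f_lin : linear f.
    by move=> a v w; rewrite /f rscaleE linearDl linearZl_LR /= mulr_algl trace_linear.
  pose f_isL := GRing.isLinear.Build F (rscal 'cV[L]_k) L _ _ f_lin.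
  pose f0 : {linear rscal 'cV[L]_k -> L} := HB.pack f f_isL.
  exact: (lfunE f0).
have trS (c : F) (y : L) : trace (theta c%:A * y) = theta c%:A * trace y.
  rewrite /trace mulr_sumr; apply: eq_bigr => i _; rewrite exprMn; congr (_ * _).
  by rewrite -rmorphXn/= exprZn expr1n expf_cardX.
rewrite /orthTr; apply: (iffP idP) => [xU u uU | xU].
  have xB v : v \in (vbasis U : seq _) -> trace (sigma x v) = 0.
    move=> vU; apply/eqP; rewrite -lE -memv_ker.
    by move: xU; rewrite (big_rem v vU) /= => /(subvP (capvSl _ _)).
  rewrite (coord_vbasis uU).
  apply: (big_ind (fun v : rscal 'cV[L]_k => trace (sigma x v) = 0))
      => [|v w v0 w0|i _].
  - by rewrite [sigma x _]linear0r linear0.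
  - have -> : sigma x (v + w) = sigma x v + sigma x w by exact: linearDr.
    by rewrite linearD /= v0 w0 addr0.
  by rewrite rscaleE linearZr_LR /= trS xB ?mulr0 ?mem_nth ?size_tuple.
rewrite big_seq; elim/big_rec: _ => [|u W uB xW]; first exact: memvf.
by rewrite memv_cap memv_ker lE xU ?eqxx // vbasis_mem.
Qed.

Definition geometric_dual sigma t (U : 'I_t -> {vspace rscal 'cV[L]_k})
    (n : 'I_t -> nat) (D : {vspace 'rV[L]_(\sum_(i < t) n i)}) : Prop :=
  associated_code (fun i => orthTr sigma (U i)) D.

End Forms.

Local Open Scope classical_set_scope.

Definition PG k : set {vspace 'cV[L]_k} := [set P | \dim P = 1%N].

Definition linear_set k (U : {vspace rscal 'cV[L]_k}) : set {vspace 'cV[L]_k} :=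
  [set P | exists2 u : 'cV[L]_k, u \in U & u != 0 /\ P = <[u]>%VS].

End SumRankCodes.

Arguments PG {F} L k.

(* Main.v *)
Require Import Defs.
From HB Require Import structures.
From mathcomp Require Import all_boot all_order all_algebra all_field.
From mathcomp Require Import boolp classical_sets.

Set Implicit Arguments.
Unset Strict Implicit.
Unset Printing Implicit Defensive.

Import GRing.Theory.
Local Open Scope classical_set_scope.
Local Open Scope ring_scope.

(* For w <> 0 let H_w be the hyperplane of all v with sigma(v, w) = 0.  The     *)
(* F-valued pairing (x, u) |-> Tr(sigma(x, u)) between the L-line of w and U_i *)
(* has left radical U_i^perp' /\ <w> and right radical U_i /\ H_w, so          *)
(*   dim U_i - dim (U_i /\ H_w) = m - dim (U_i^perp' /\ <w>).                  *)
(* The left side is the rank of the i-th block of the codeword attached to     *)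
(* H_w, hence that codeword has weight t m - sum_i dim (U_i^perp' /\ <w>).     *)
(* So C is one-weight iff the last sum does not depend on w; it is then equal  *)
(* to its maximum, which gives the generalized weight of order k - 1 of the    *)
(* dual.  If the sum is 0 for one w, it is 0 for all of them, and d_1(C) = t m.*)

(** The sum attached to [w] is [dual_weight w]. The count above is [dim_orthTr_line], an instance of
    [pairing_dim]; together with rank-nullity on each block ([rk_mulmx]) it gives [weight_add_dual].
    By [form_orth_row] and [row_form_orth], every functional v |-> sigma(v, w) with w <> 0 is a
    nonzero row, and every nonzero row arises so; hence the nonzero w account for all nonzero
    codewords, which yields [one_weight_dual]. The subspaces of codimension k - 1 are the lines <w>,
    so the order k - 1 weight of the dual is its length minus the maximum of [dual_weight]. It
    equals the length minus [dual_weight w] for every w exactly when [dual_weight] is constant. For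
    the covering statement, <w> lies on some L_(U_i^perp') as soon as [dual_weight w] is nonzero,
    and [gen_weight1_dual_eq0] excludes the value 0. *)

Section Pairing.
Context (K : fieldType).

(** Evaluating [B x] on a basis of [Y] is linear in [x] and injective on [X], so [X] embeds in a
    space of dimension [\dim Y]. *)
Lemma pairing_dim_le {V W : vectType K} {h : K -> K} {B : V -> W -> K}
    {X : {vspace V}} {Y : {vspace W}} :
  (forall y a x x', B (a *: x + x') y = a * B x y + B x' y) ->
  (forall x a y y', B x (a *: y + y') = h a * B x y + B x y') -> h 1 = 1 ->
  {in X, forall x, {in Y, forall y, B x y = 0} -> x = 0} ->
  (\dim X <= \dim Y)%N.
Proof.
move=> Bl Br h1 X0.
have B0 x : B x 0 = 0.
  by apply: (@addrI _ (B x 0)); rewrite addr0 -{1}[B x 0]mul1r -h1 -Br scale1r addr0.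
pose g (x : V) : 'rV[K]_(\dim Y) := \row_j B x (vbasis Y)`_j.
have g_lin : linear g.
  by move=> a x x'; apply/rowP=> j; rewrite !mxE Bl.
pose g_isL := GRing.isLinear.Build K V 'rV[K]_(\dim Y) _ _ g_lin.
pose g0 : {linear V -> 'rV[K]_(\dim Y)} := HB.pack g g_isL.
have gker : (X :&: lker (linfun g0) = 0)%VS.
  apply/eqP; rewrite -subv0; apply/subvP=> x.
  rewrite memv_cap memv_ker lfunE memv0 => /andP[xX /eqP/rowP gx0].
  apply/eqP/X0 => // y yY; rewrite (coord_vbasis yY).
  apply: (big_ind (fun y => B x y = 0)) => // [u v u0 v0|j _].
    by rewrite -[u]scale1r Br u0 v0 mulr0 addr0.
  by have := gx0 j; rewrite !mxE -[_ *: _]addr0 Br B0 addr0 => ->; rewrite mulr0.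
rewrite -(limg_ker_dim (linfun g0) X) gker dimv0 add0n.
by rewrite (leq_trans (dimvS (subvf _))) // dimvf /dim /= mul1n.
Qed.

(* Both sides measure the rank of the pairing between [X] and [Y]: it is       *)
(* nondegenerate between complements of the radicals [X0] and [Y0].            *)
Lemma pairing_dim {V W : vectType K} {phi psi : {rmorphism K -> K}}
    {B : V -> W -> K} {X X0 : {vspace V}} {Y Y0 : {vspace W}} :
  cancel phi psi ->
  (forall y a x x', B (a *: x + x') y = a * B x y + B x' y) ->
  (forall x a y y', B x (a *: y + y') = phi a * B x y + B x y') ->
  (forall x, x \in X0 <-> x \in X /\ {in Y, forall y, B x y = 0}) ->
  (forall y, y \in Y0 <-> y \in Y /\ {in X, forall x, B x y = 0}) ->
  (\dim X + \dim Y0 = \dim Y + \dim X0)%N.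
Proof.
move=> phiK Bl Br X0E Y0E.
have sX : (X0 <= X)%VS by apply/subvP=> x /X0E[].
have sY : (Y0 <= Y)%VS by apply/subvP=> y /Y0E[].
rewrite -(dimv_cap_compl X X0) -(dimv_cap_compl Y Y0) (capv_idPr sX) (capv_idPr sY).
suff -> : \dim (X :\: X0) = \dim (Y :\: Y0) by rewrite addnAC [RHS]addnAC (addnC (\dim X0)).
have B0r x : B x 0 = 0.
  apply: (@addrI _ (B x 0)); rewrite addr0 -{1}[B x 0]mul1r -(rmorph1 phi) -Br.
  by rewrite scale1r addr0.
have B0l y : B 0 y = 0.
  by apply: (@addrI _ (B 0 y)); rewrite addr0 -{1}[B 0 y]mul1r -Bl scale1r addr0.
have BDl y x x' : B (x + x') y = B x y + B x' y by rewrite -[x]scale1r Bl mul1r scale1r.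
have BDr x y y' : B x (y + y') = B x y + B x y'.
  by rewrite -[y]scale1r Br rmorph1 mul1r scale1r.
have decomp (Z : vectType K) (A A0 : {vspace Z}) z : (A0 <= A)%VS -> z \in A ->
    exists2 z1, z1 \in (A :\: A0)%VS & exists2 z0, z0 \in A0 & z = z1 + z0.
  move=> sA zA; suff: z \in (A :\: A0 + A0)%VS.
    by case/memv_addP=> z1 z1A [z0 z0A ->]; exists z1 => //; exists z0.
  by rewrite addv_diff (addv_idPl sA).
apply/eqP; rewrite eqn_leq; apply/andP; split.
- apply: (pairing_dim_le Bl Br (rmorph1 phi)) => x xX xB.
  apply/eqP; rewrite -memv0 -(capv_diff X X0) memv_cap xX /=.
  have xX' : x \in X by apply: subvP (diffvSl _ _) _ xX.
  apply/X0E; split=> // y /(decomp _ _ _ _ sY)[y1 y1Y [y0 /Y0E[_ y0X] ->]].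
  by rewrite BDr xB // y0X // addr0.
(* With the arguments swapped, composing with [psi] undoes [phi]: the pairing becomes linear in [y]
   and [psi]-semilinear in [x]. *)
- apply: (@pairing_dim_le W V psi (fun y x => psi (B x y))) => [x a y y'|y a x x'||y yY yB].
  + by rewrite Br rmorphD rmorphM phiK.
  + by rewrite Bl rmorphD rmorphM.
  + exact: rmorph1.
  apply/eqP; rewrite -memv0 -(capv_diff Y Y0) memv_cap yY /=.
  have yY' : y \in Y by apply: subvP (diffvSl _ _) _ yY.
  apply/Y0E; split=> // x /(decomp _ _ _ _ sX)[x1 x1X [x0 /X0E[_ x0Y] ->]].
  rewrite BDl x0Y // addr0; apply: (fmorph_inj psi).
  by rewrite rmorph0 yB.
Qed.

End Pairing.

(** * The trace and the base field *)

Section Trace.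
Context {F : finFieldType} {L : fieldExtType F}.

Lemma fixed_base_field (y : L) : y ^+ #|F| = y -> exists c : F, y = c%:A.
Proof.
move=> yq; suff: y \in (1%AS : {vspace L}) by case/vlineP=> c ->; exists c.
by rewrite Fermat's_little_theorem dimv1 expn1 yq.
Qed.

(** F is the set of roots of y^q = y in L, which [theta] preserves. The induced endomorphism of F is
    injective, hence bijective because F is finite. *)
Lemma rmorph_base_field (theta : {rmorphism L -> L}) :
  exists phi psi : {rmorphism F -> F},
    cancel phi psi /\ forall a, theta a%:A = (phi a)%:A.
Proof.
have /choice[phi phiE] a : exists c : F, theta a%:A = c%:A.
  by apply: fixed_base_field; rewrite -rmorphXn/= exprZn expr1n expf_card.
have inj_alg : injective (in_alg L) by apply: fmorph_inj.
have phiB : zmod_morphism phi.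
  by move=> a b; apply: inj_alg; rewrite rmorphB /= -!phiE -rmorphB -scalerBl.
have phiM : monoid_morphism phi.
  have AM a b : (a * b)%:A = a%:A * b%:A :> L by exact: (rmorphM (in_alg L)).
  split=> [|a b]; apply: inj_alg; rewrite /= -?phiE ?scale1r ?rmorph1 //.
  by rewrite !AM -!phiE rmorphM.
pose phi_add := GRing.isZmodMorphism.Build F F phi phiB.
pose phi_mul := GRing.isMonoidMorphism.Build F F phi phiM.
pose phi0 : {rmorphism F -> F} := HB.pack phi phi_add phi_mul.
have phiI : injective phi0 by apply: fmorph_inj.
have phiK := f_invF phiI; have psiK := invF_f phiI.
pose psi_add := GRing.isZmodMorphism.Build F F (invF phiI) (can2_zmod_morphism psiK phiK).
pose psi_mul := GRing.isMonoidMorphism.Build F F (invF phiI) (can2_monoid_morphism psiK phiK).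
pose psi0 : {rmorphism F -> F} := HB.pack (invF phiI) psi_add psi_mul.
by exists phi0, psi0.
Qed.

Lemma expr_card_ext (y : L) : y ^+ (#|F| ^ \dim {:L}) = y.
Proof. by apply/eqP; rewrite -(Fermat's_little_theorem {:L}%AS) memvf. Qed.

(** Raising to the power q permutes the conjugates cyclically, the last one returning to y since
    y^(q^m) = y; so the trace is fixed by this power map. *)
Lemma trace_base_field (y : L) : exists c : F, trace y = c%:A.
Proof.
apply: fixed_base_field; rewrite /trace.
have [p _ pF] := finPcharP F.
have pL : p \in [pchar L] by rewrite pchar_lalg.
have natF : [pchar L].-nat #|F|.
  rewrite (eq_pnat _ (pcharf_eq pL)) -cardsT.
  exact/abelian.abelem_pgroup/abelian.fin_ring_pchar_abelem.
rewrite (big_morph (fun x : L => x ^+ #|F|) (id1 := 0) (op1 := +%R)); first last.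
- by rewrite expr0n gtn_eqF // (ltnW (finNzRing_gt1 F)).
- by move=> x z; rewrite exprDn_pchar.
have: (0 < \dim {:L})%N by rewrite adim_gt0.
case m: (\dim {:L}) => [//|d] _.
rewrite big_ord_recr [RHS]big_ord_recl /= -exprM -expnSr -m expr_card_ext addrC expn0 expr1.
by congr (_ + _); apply: eq_bigr => i _; rewrite -exprM -expnSr.
Qed.

(** The trace is given by a polynomial of degree below q^m = |L| whose coefficient at X is 1, so it
    cannot vanish on all of L. *)
Lemma trace_neq0 : exists z : L, trace z != 0.
Proof.
apply/not_existsP => /= trz.
have m0 : (0 < \dim {:L})%N by rewrite adim_gt0.
have q1 : (1 < #|F|)%N by apply: finNzRing_gt1.
pose p : {poly L} := \sum_(i < \dim {:L}) 'X^(#|F| ^ i).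
(* [finvect_type L] is L with its finite type structure, which allows its elements to be
   enumerated. *)
pose rs : seq L := enum (finvect_type L).
have sz_rs : size rs = (#|F| ^ \dim {:L})%N.
  rewrite -(card_vspace {:finvect_type L}) card_vspacef.
  exact/esym/(@cardT (finvect_type L)).
have coefp : p`_(#|F| ^ 0) = 1.
  rewrite /p coef_sum (bigD1 (Ordinal m0)) //= coefXn eqxx big1 ?addr0 // => i i0.
  rewrite coefXn eqn_exp2l //; case: eqP => // i0'.
  by case/eqP: i0; apply: val_inj.
have p0 : p != 0 by apply: contra_eq_neq coefp => ->; rewrite coef0 eq_sym oner_eq0.
have := max_poly_roots p0 _ (enum_uniq (finvect_type L)); rewrite -/rs sz_rs.
have -> : all (root p) rs.
  apply/allP=> x _; rewrite /root /p horner_sum.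
  have /negP/negPn/eqP trx := trz x.
  by rewrite -[X in _ == X]trx; apply/eqP/eq_bigr => i _; rewrite hornerXn.
move=> /(_ isT); apply/negP; rewrite -leqNgt.
apply: leq_trans (size_sum _ _ _) _; apply/bigmax_leqP => i _.
by rewrite size_polyXn ltn_exp2l.
Qed.

End Trace.

(** * Lines over F, and codewords as products with a generator matrix *)

Lemma dim_rspace_line {F : fieldType} {L : fieldExtType F} {V : vectType L} (w : V) :
  w != 0 -> \dim (rspace <[w]>) = \dim {:L}.
Proof.
move=> w0; have w_inj : injective (fun c : L => c *: w).
  move=> c d /eqP; rewrite -subr_eq0 -scalerBl scaler_eq0 (negPf w0) orbF subr_eq0.
  by move/eqP.
pose f (c : L) : rscal V := c *: w.
have f_lin : linear f.
  by move=> a b c; rewrite /f scalerDl rscaleE -[a *: b]mulr_algl scalerA.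
pose f_isL := GRing.isLinear.Build F L (rscal V) _ _ f_lin.
pose f0 : {linear L -> rscal V} := HB.pack f f_isL.
have fE c : linfun f0 c = c *: w by rewrite lfunE.
have -> : rspace <[w]> = (linfun f0 @: fullv)%VS.
  apply/vspaceP=> v; rewrite mem_rspace; apply/vlineP/memv_imgP => [[c ->]|[c _ ->]].
    by exists c; rewrite ?memvf ?fE.
  by exists c; rewrite fE.
rewrite limg_dim_eq // (_ : lker _ = 0%VS) ?capv0 //.
by apply/eqP/lker0P=> c d; rewrite !fE => /w_inj.
Qed.

(** Rank-nullity for the F-linear map v |-> a v on the column span: its image is spanned by the
    entries of [a *m X], its kernel is the part lying in [H]. *)
Lemma rk_mulmx {F : finFieldType} {L : fieldExtType F} {k b : nat}
    (a : 'rV[L]_k) (X : 'M[L]_(k, b)) (H : {vspace 'cV[L]_k}) :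
  (forall v, (v \in H) = ((a *m v) 0 0 == 0)) ->
  (rk (a *m X) + \dim (<<columns X>> :&: rspace H) = \dim <<columns X>>)%N.
Proof.
move=> HE; pose f (v : rscal 'cV[L]_k) : L := (a *m v) 0 0.
have f_lin : linear f.
  by move=> c u v; rewrite /f rscaleE mulmxDr -scalemxAr !mxE mulr_algl.
pose f_isL := GRing.isLinear.Build F (rscal 'cV[L]_k) L _ _ f_lin.
pose f0 : {linear rscal 'cV[L]_k -> L} := HB.pack f f_isL.
rewrite addnC -[RHS](limg_ker_dim (linfun f0)); congr (_ + _)%N; congr (\dim _).
  apply/vspaceP=> v; rewrite !memv_cap; congr (_ && _).
  by rewrite memv_ker lfunE mem_rspace HE.
rewrite limg_span -map_comp; congr span; apply: eq_map => j.
by rewrite /comp lfunE /= /f !mxE; apply: eq_bigr => i _; rewrite mxE.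
Qed.

Lemma codeword_mulmx {F : finFieldType} {L : fieldExtType F} {k b : nat}
    {C : {vspace 'rV[L]_b}} {G : 'M[L]_(k, b)} : generator_matrix C G ->
  forall x, reflect (exists a : 'rV[L]_k, x = a *m G) (x \in C).
Proof.
move=> /generator_basis bG x; apply: (iffP idP) => [xC|[a ->]].
  exists (\row_i coord (mktuple (fun i => row i G)) i x).
  rewrite {1}(coord_basis bG xC) mulmx_sum_row.
  by apply: eq_bigr => i _; rewrite mxE nth_mktuple.
rewrite mulmx_sum_row; apply: memv_suml => i _; apply: memvZ.
by rewrite -(nth_mktuple (fun i => row i G) 0) (basis_mem bG) ?mem_nth ?size_tuple.
Qed.

Lemma mulmx_generator_eq0 {F : finFieldType} {L : fieldExtType F} {k b : nat}
    {C : {vspace 'rV[L]_b}} {G : 'M[L]_(k, b)} (a : 'rV[L]_k) :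
  generator_matrix C G -> (a *m G == 0) = (a == 0).
Proof.
move=> /generator_basis bG; apply/eqP/eqP => [|->]; last by rewrite mul0mx.
rewrite mulmx_sum_row => aG0; have /freeP fG := basis_free bG.
apply/rowP=> i; rewrite mxE; apply: (fG (a 0)).
by rewrite -[RHS]aG0; apply: eq_bigr => j _; rewrite nth_mktuple.
Qed.

(** * Orthogonality for sigma and for its trace *)

Section FormDuality.
Context {F : finFieldType} {L : fieldExtType F} {k : nat} {theta : {rmorphism L -> L}}.
Variable sigma : {bilinear 'cV[L]_k -> 'cV[L]_k -> L | *%R & theta \; *%R}.
Hypotheses (sigma_nondeg : nondegenerate_form sigma)
  (sigma_refl : reflexive_form sigma).
Implicit Types (U X : {vspace rscal 'cV[L]_k}) (u v w : 'cV[L]_k).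

Lemma sigma_eq0C u v : (sigma u v == 0) = (sigma v u == 0).
Proof. by apply/eqP/eqP; apply: sigma_refl. Qed.

(** The hyperplane H_w. The vector [w] is on the right because sigma is L-linear on the left
    only. *)
Definition form_orth w : {vspace 'cV[L]_k} :=
  lker (linfun (fun v => sigma v w : L^o)).

Lemma mem_form_orth w v : (v \in form_orth w) = (sigma v w == 0).
Proof.
pose f v : L^o := sigma v w.
have f_lin : linear f by move=> a x y; rewrite /f linearDl linearZl_LR.
pose f_isL := GRing.isLinear.Build L 'cV[L]_k L^o _ _ f_lin.
pose f0 : {linear 'cV[L]_k -> L^o} := HB.pack f f_isL.
rewrite memv_ker; congr (_ == 0); exact: (lfunE f0).
Qed.

Lemma dim_form_orth w : w != 0 -> \dim (form_orth w) = k.-1.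
Proof.
move=> w0; have dimV : \dim {: 'cV[L]_k} = k by rewrite dimvf /dim /= muln1.
apply/eqP; rewrite eqn_leq; apply/andP; split.
  have: (\dim (form_orth w) < \dim {: 'cV[L]_k})%N.
    rewrite ltn_neqAle dimvS ?subvf // andbT.
    apply: contra_neq w0 => dimE; apply: sigma_nondeg => y.
    apply/eqP; rewrite sigma_eq0C -mem_form_orth.
    suff -> : form_orth w = fullv by exact: memvf.
    by apply/eqP; rewrite eqEdim subvf dimE leqnn.
  by rewrite dimV => lt_k; rewrite -ltnS (ltn_predK lt_k).
have := limg_ker_dim (linfun (fun v => sigma v w : L^o)) fullv.
rewrite capfv dimV => /esym defk; rewrite -subn1 leq_subLR addnC [X in (X <= _)%N]defk.
by rewrite leq_add2l (leq_trans (dimvS (subvf _))) // dimvf.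
Qed.

Lemma hyperplane_form_orth (H : {vspace 'cV[L]_k}) :
  (\dim H + 1 = k)%N -> exists2 w, w != 0 & H = form_orth w.
Proof.
move=> dimH; have dimV : \dim {: 'cV[L]_k} = k by rewrite dimvf /dim /= muln1.
have [w [w0 wH]] : exists w, w != 0 /\ {in H, forall y, sigma w y = 0}.
  apply/not_existsP => noW.
  (* Without such a [w], the pairing of the whole space with [H] has trivial left radical, which
     forces k <= dim H. *)
  have: (\dim {: 'cV[L]_k} <= \dim H)%N.
    apply: (@pairing_dim_le L _ _ theta (fun x y => sigma x y)) => [y a x x'|x a y y'||x _ xH].
    - by rewrite linearDl linearZl_LR.
    - by rewrite linearDr linearZr_LR.
    - exact: rmorph1.
    by apply/eqP/negPn/negP => x0; apply: (noW x).
  by rewrite dimV -{1}dimH addn1 ltnn.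
exists w => //; apply/eqP; rewrite eqEdim dim_form_orth // -(congr1 predn dimH) addn1 leqnn andbT.
by apply/subvP=> y yH; rewrite mem_form_orth sigma_eq0C wH.
Qed.

(** [pairing_dim] for the trace form, whose left radical in [X] is [orthTr sigma U :&: X]. The right
    radical [Y0] stays a parameter: it is U /\ H_w when [X] is the line of w, and 0 when [X] is the
    whole space. *)
Lemma orthTr_pairing U X (Y0 : {vspace rscal 'cV[L]_k}) :
  (forall u : rscal 'cV[L]_k, u \in Y0 <->
     u \in U /\ {in X, forall x : rscal 'cV[L]_k, trace (sigma x u) = 0}) ->
  (\dim X + \dim Y0 = \dim U + \dim (orthTr sigma U :&: X))%N.
Proof.
move=> Y0E; have [phi [psi [phiK thetaE]]] := rmorph_base_field theta.
(* [trace] takes values in L; [trF] is its coordinate in F, so that the pairing is F-valued. *)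
have /choice[trF trE] := @trace_base_field F L.
have inj_alg : injective (in_alg L) by apply: fmorph_inj.
have trF0 x : trF x = 0 <-> trace x = 0.
  rewrite trE; split=> [->|/eqP]; first by rewrite scale0r.
  by rewrite scaler_eq0 oner_eq0 orbF => /eqP.
have trFB a x y : trF (a%:A * x + y) = a * trF x + trF y.
  apply: inj_alg; rewrite /= -trE mulr_algl linearP /= !trE.
  by rewrite scalerDl scalerA.
apply: (@pairing_dim F _ _ phi psi (fun x u : rscal 'cV[L]_k => trF (sigma x u))) => //.
- by move=> y a x x'; rewrite rscaleE linearDl linearZl_LR /= trFB.
- by move=> x a y y'; rewrite rscaleE linearDr linearZr_LR /= thetaE trFB.
- move=> x; rewrite memv_cap; split=> [/andP[/mem_orthTr xU xX]|[xX xU]].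
    by split=> // u uU; apply/trF0/xU.
  by rewrite xX andbT; apply/mem_orthTr => u uU; apply/trF0/xU.
move=> u; rewrite Y0E; split=> -[uU uX]; split=> // x xX.
  exact/trF0/uX.
exact/trF0/uX.
Qed.

(** If sigma(w, u) <> 0, then sigma(c w, u) runs over all of L as c varies, including an element of
    nonzero trace. *)
Lemma trace_form_line w u :
  {in rspace <[w]>, forall x : rscal 'cV[L]_k, trace (sigma x u) = 0} <-> sigma u w = 0.
Proof.
split=> [wu|/sigma_refl wu x].
  apply: sigma_refl; apply: contrapT => /eqP swu.
  have [z /eqP[]] := @trace_neq0 F L.
  rewrite -(divfK swu z) -linearZl_LR; apply: wu.
  by rewrite mem_rspace memvZ ?memv_line.
by rewrite mem_rspace => /vlineP[c ->]; rewrite linearZl_LR /= wu mulr0 linear0.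
Qed.

Lemma dim_orthTr_line U w : w != 0 ->
  (\dim {:L} + \dim (U :&: rspace (form_orth w))
   = \dim U + \dim (orthTr sigma U :&: rspace <[w]>))%N.
Proof.
move=> w0; rewrite -(dim_rspace_line w0); apply: orthTr_pairing => u.
rewrite memv_cap mem_rspace mem_form_orth; split=> [/andP[uU /eqP uw]|[uU uw]].
  by split=> //; apply/trace_form_line.
by rewrite uU; apply/eqP/trace_form_line.
Qed.

Lemma dim_orthTr U : (\dim U + \dim (orthTr sigma U) = k * \dim {:L})%N.
Proof.
rewrite -{1}[orthTr _ _]capvf -(@orthTr_pairing _ _ 0%VS).
  by rewrite dimv0 addn0 dimvf /dim /= dimvf /dim /= muln1.
move=> u; rewrite memv0; split=> [/eqP->|[_ u0]].
  split=> [|x _]; first exact: mem0v.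
  by rewrite linear0r linear0.
apply/eqP/sigma_nondeg => y; apply/trace_form_line => x _; exact: u0 (memvf _).
Qed.

Lemma form_orth_row w : w != 0 ->
  exists2 a : 'rV[L]_k, a != 0 & forall v, sigma v w = (a *m v) 0 0.
Proof.
move=> w0; pose a : 'rV[L]_k := \row_j sigma (delta_mx j 0) w.
have aE v : sigma v w = (a *m v) 0 0.
  rewrite {1}(matrix_sum_delta v) linear_sumlz mxE; apply: eq_bigr => i _.
  by rewrite big_ord1 linearZl_LR /= !mxE mulrC.
exists a => //; apply: contra_neq w0 => a0; apply: sigma_nondeg => y.
by apply: sigma_refl; rewrite aE a0 mul0mx mxE.
Qed.

(** Sending w to its row of values on the standard basis is injective by nondegeneracy. It is only
    semilinear over L, so surjectivity is drawn from finiteness rather than from dimensions. *)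
Lemma row_form_orth (a : 'rV[L]_k) : a != 0 ->
  exists2 w, w != 0 & forall v, sigma v w = (a *m v) 0 0.
Proof.
move=> a0; pose f (w : 'cV[finvect_type L]_k) : 'cV[finvect_type L]_k :=
  \col_j sigma (delta_mx j 0) w.
have fE (v w : 'cV[L]_k) : sigma v w = \sum_j v j 0 * f w j 0.
  rewrite {1}(matrix_sum_delta v) linear_sumlz; apply: eq_bigr => i _.
  by rewrite big_ord1 linearZl_LR /= !mxE.
have f_inj : injective f.
  move=> w w' ff'; apply/subr0_eq/sigma_nondeg => y; apply: sigma_refl.
  by rewrite linearBr !fE ff' subrr.
have /codomP[w wE] := injF_onto f_inj (a^T : 'cV[finvect_type L]_k).
have sE v : sigma v w = (a *m v) 0 0.
  by rewrite fE -wE mxE; apply: eq_bigr => i _; rewrite mxE mulrC.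
exists w => //; apply: contra_neq a0 => w0; apply/rowP=> j.
have := sE (delta_mx j 0); rewrite w0 linear0r => /esym.
by rewrite -colE !mxE.
Qed.

End FormDuality.

(** * Dimensions of systems and generalized weights *)

Lemma dim1_vline {K : fieldType} {V : vectType K} (P : {vspace V}) :
  \dim P = 1%N -> vpick P != 0 /\ P = <[vpick P]>%VS.
Proof.
move=> dimP; have p0 : vpick P != 0 by rewrite vpick0 -dimv_eq0 dimP.
split=> //; apply/esym/eqP; rewrite eqEdim dim_vline p0 dimP leqnn andbT.
by rewrite -memvE memv_pick.
Qed.

(** The matrix with free columns and the one defining [U] differ by an invertible factor, which
    preserves dimensions of column spans. *)
Lemma associated_system_dim {F : finFieldType} {L : fieldExtType F} {k t : nat}
    {n : 'I_t -> nat} {C : {vspace 'rV[L]_(\sum_(i < t) n i)}}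
    {U : 'I_t -> {vspace rscal 'cV[L]_k}} :
  associated_system C U -> nondegenerate_code C -> forall i, \dim (U i) = n i.
Proof.
case=> G bG UE [G' bG' freeG'] i; move: G' bG' freeG'.
rewrite (generator_dim bG) => G' bG' freeG'.
have [A Au defG] := generator_change bG' bG.
have [H' _ capH'] := columns_mul fullv Au.
have szc (X : 'M[L]_(k, n i)) : size (columns X) = n i by rewrite size_map size_enum_ord.
apply/eqP; rewrite eqn_leq; apply/andP; split.
  by rewrite UE -[X in (_ <= X)%N](szc (submxrow G i)) dim_span.
have /eqP := freeG' i; rewrite szc => {1}<-.
rewrite UE defG -mul_submxrow -[X in (\dim X <= _)%N]capvf.
have <- : rspace {: 'cV[L]_k} = fullv by apply/vspaceP=> v; rewrite mem_rspace !memvf.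
by rewrite -capH' dimvS // capvSl.
Qed.

Lemma associated_code_dim {F : finFieldType} {L : fieldExtType F} {k t : nat}
    {n : 'I_t -> nat} {C : {vspace 'rV[L]_(\sum_(i < t) n i)}}
    {U : 'I_t -> {vspace rscal 'cV[L]_k}} :
  associated_code U C -> associated_system C U /\ forall i, \dim (U i) = n i.
Proof.
case=> G bG bU; split=> [|i]; first by exists G => // i; have /andP[/eqP] := bU i.
have /andP[/eqP<- /eqP->] := bU i.
by rewrite size_map size_enum_ord.
Qed.

(** The maximum ranges over the single value [s]. A witness [H] keeps it from being an empty
    maximum, and [s <= M] puts [s] in the index range. *)
Lemma system_gen_weight_const {F : finFieldType} {L : fieldExtType F} {k t : nat}
    (U : 'I_t -> {vspace rscal 'cV[L]_k}) (M r s : nat) :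
  (exists H : {vspace 'cV[L]_k}, \dim H + r = k)%N ->
  (forall H : {vspace 'cV[L]_k}, \dim H + r = k ->
     \sum_(i < t) \dim (U i :&: rspace H) = s)%N ->
  (s <= M)%N -> system_gen_weight U M r = (M - s)%N.
Proof.
move=> [H dimH] sumH; rewrite -ltnS => sM; rewrite /system_gen_weight; congr subn.
rewrite (big_pred1 (Ordinal sM)) // => d; apply/asboolP/eqP => [[H' dimH' dE]|->].
  by apply: val_inj; rewrite /= -dE sumH.
by exists H => //; apply: sumH.
Qed.

(** * Weights of codewords against intersections with the dual system *)

Section OneWeight.
Context {F : finFieldType} {L : fieldExtType F} {k t : nat} {theta : {rmorphism L -> L}}.
Variables (n : 'I_t -> nat) (C : {vspace 'rV[L]_(\sum_(i < t) n i)}).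
Variable U : 'I_t -> {vspace rscal 'cV[L]_k}.
Variable sigma : {bilinear 'cV[L]_k -> 'cV[L]_k -> L | *%R & theta \; *%R}.
Hypotheses (sigma_nondeg : nondegenerate_form sigma)
  (sigma_refl : reflexive_form sigma) (CU : associated_system C U).

Definition dual_weight (w : 'cV[L]_k) : nat :=
  \sum_(i < t) \dim (orthTr sigma (U i) :&: rspace <[w]>)%VS.

(** In each block, [rk_mulmx] and [dim_orthTr_line] share the term dim (U_i /\ H_w); cancelling it
    leaves m per block. *)
Lemma weight_add_dual (G : 'M[L]_(k, \sum_(i < t) n i)) (a : 'rV[L]_k) (w : 'cV[L]_k) :
  (forall i, U i = <<columns (submxrow G i)>>%VS) ->
  w != 0 -> (forall v, sigma v w = (a *m v) 0 0) ->
  (sumrank_weight (a *m G) + dual_weight w = t * \dim {:L})%N.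
Proof.
move=> UE w0 aw; rewrite /sumrank_weight /dual_weight -big_split /=.
rewrite (eq_bigr (fun=> \dim {:L})) ?sum_nat_const ?card_ord // => i _.
have rkE : (rk (submxrow (a *m G) i) + \dim (U i :&: rspace (form_orth sigma w))
            = \dim (U i))%N.
  by rewrite -mul_submxrow UE; apply: rk_mulmx => v; rewrite mem_form_orth aw.
have := dim_orthTr_line sigma_refl (U i) w0; rewrite -rkE addnAC => /eqP.
by rewrite eqn_add2r => /eqP.
Qed.

Lemma one_weight_dual :
  one_weight C <->
  forall w w', w != 0 -> w' != 0 -> dual_weight w = dual_weight w'.
Proof.
have [G bG UE] := CU; split=> [oneC w w' w0 w0'|dualC x y].
  have [a a0 aw] := form_orth_row sigma_nondeg sigma_refl w0.
  have [b b0 bw] := form_orth_row sigma_nondeg sigma_refl w0'.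
  have wE := weight_add_dual UE w0 aw; have wE' := weight_add_dual UE w0' bw.
  apply/eqP; rewrite -(eqn_add2l (sumrank_weight (a *m G))) wE -wE' eqn_add2r.
  apply/eqP/oneC; rewrite ?(mulmx_generator_eq0 _ bG) //.
    by apply/(codeword_mulmx bG); exists b.
  by apply/(codeword_mulmx bG); exists a.
move=> /(codeword_mulmx bG)[a ->] /(codeword_mulmx bG)[b ->].
rewrite !(mulmx_generator_eq0 _ bG) => a0 b0.
have [w w0 aw] := row_form_orth sigma_nondeg sigma_refl a0.
have [w' w0' bw] := row_form_orth sigma_nondeg sigma_refl b0.
apply/eqP; rewrite -(eqn_add2r (dual_weight w)) (weight_add_dual UE w0 aw).
by rewrite (dualC _ _ w0 w0') (weight_add_dual UE w0' bw).
Qed.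

(** Every hyperplane is some H_w, and here all of them meet the system in total dimension N - tm, so
    d_1 = N - (N - tm). *)
Lemma gen_weight1_dual_eq0 (N := (\sum_(i < t) n i)%N) : (2 <= k)%N ->
  (forall i, \dim (U i) = n i) -> (forall w, w != 0 -> dual_weight w = 0%N) ->
  gen_weight C 1 = (t * \dim {:L})%N.
Proof.
move=> k2 dimU dual0.
have sumH w : w != 0 ->
    (t * \dim {:L} + \sum_(i < t) \dim (U i :&: rspace (form_orth sigma w)) = N)%N.
  move=> w0; transitivity (N + dual_weight w)%N; last by rewrite dual0 ?addn0.
  have -> : (t * \dim {:L} = \sum_(i < t) \dim {:L})%N by rewrite sum_nat_const card_ord.
  rewrite /N /dual_weight -!big_split /=.
  by apply: eq_bigr => i _; rewrite -dimU dim_orthTr_line.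
(* Any nonzero vector serves: it provides a hyperplane and the bound tm <= N. *)
pose w : 'cV[L]_k := const_mx 1.
have w0 : w != 0.
  apply/eqP=> /colP/(_ (Ordinal (ltnW k2)))/eqP; rewrite !mxE.
  by rewrite oner_eq0.
have tN : (t * \dim {:L} <= N)%N by rewrite -(sumH w w0) leq_addr.
rewrite (gen_weightE _ CU) (@system_gen_weight_const _ _ _ _ _ _ _ (N - t * \dim {:L})).
- by rewrite subKn.
- by exists (form_orth sigma w); rewrite dim_form_orth // addn1 prednK // ltnW.
- move=> H /(hyperplane_form_orth sigma_nondeg sigma_refl)[v v0 ->].
  by rewrite -(sumH v v0) addKn.
exact: leq_subr.
Qed.

End OneWeight.

Theorem proposition4p6 (F : finFieldType) (L : fieldExtType F) (k t : nat)
    (n : 'I_t -> nat) (C : {vspace 'rV[L]_(\sum_(i < t) n i)})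
    (U : 'I_t -> {vspace rscal 'cV[L]_k}) (theta : {rmorphism L -> L})
    (sigma : {bilinear 'cV[L]_k -> 'cV[L]_k -> L | *%R & theta \; *%R})
    (hk : (2 <= k)%N)
    (hsigma : nondegenerate_form sigma) (hrefl : reflexive_form sigma)
    (hdim : \dim C = k) (hC : nondegenerate_code C) (hU : associated_system C U)
    (hcap : forall P : {vspace 'cV[L]_k},
      \dim P = 1%N -> ~~ (rspace P <= \bigcap_(i < t) U i)%VS) :
  (forall (n' : 'I_t -> nat) (D : {vspace 'rV[L]_(\sum_(i < t) n' i)}),
     geometric_dual sigma U D ->
     one_weight C <->
     forall w : 'cV[L]_k, w != 0 ->
       gen_weight D k.-1 =
         (t * \dim {:L} * k - \sum_(i < t) n i
            - \sum_(i < t) \dim (orthTr sigma (U i) :&: rspace <[w]>)%VS)%N)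
  /\ (one_weight C -> gen_weight C 1 <> (t * \dim {:L})%N ->
      \bigcup_i linear_set (orthTr sigma (U i)) = PG L k).
Proof.
have dimU := associated_system_dim hU hC.
have oneE := one_weight_dual hsigma hrefl hU.
split=> [n' D /associated_code_dim[DU dimD]|].
  (* Summing [dim_orthTr] over the blocks gives the length of the dual. *)
  have ME : (t * \dim {:L} * k - \sum_(i < t) n i = \sum_(i < t) n' i)%N.
    rewrite -mulnA [X in (t * X)%N]mulnC -{1}(card_ord t) -sum_nat_const.
    rewrite -(eq_bigr _ (fun i _ => dim_orthTr hsigma hrefl (U i))) big_split /=.
    by rewrite (eq_bigr _ (fun i _ => dimU i)) addKn; apply: eq_bigr.
  have leM w : (dual_weight U sigma w <= \sum_(i < t) n' i)%N.
    by apply: leq_sum => i _; rewrite -dimD dimvS // capvSl.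
  rewrite oneE ME; split=> [dualC w w0|wE w w' w0 w0'].
    rewrite (gen_weightE _ DU); apply: system_gen_weight_const => [|H dimH|].
    - by exists <[w]>%VS; rewrite dim_vline w0 add1n prednK // ltnW.
    - have {}dimH : \dim H = 1%N.
        by apply/eqP; rewrite -(eqn_add2r k.-1) dimH add1n prednK // ltnW.
      by have [v0 ->] := dim1_vline dimH; apply: dualC.
    exact: leM.
  (* Subtraction on naturals truncates; the bound [leM] makes it reversible, so equal differences
     give equal dual weights. *)
  by rewrite -(subKn (leM w)) -(wE w w0) (wE w' w0') (subKn (leM w')).
move=> /oneE dualC gen1; apply/seteqP; split=> P.
  by case=> i _ [u _ [u0 ->]]; rewrite /PG /= dim_vline u0.
move=> /dim1_vline; set w := vpick P => -[w0 ->].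
(* Constancy would spread a zero at [w] to all vectors and make d_1 equal to tm. *)
have: dual_weight U sigma w != 0%N.
  apply/eqP=> e0; apply: gen1.
  apply: (gen_weight1_dual_eq0 hsigma hrefl hU hk dimU) => v v0.
  by rewrite (dualC _ _ v0 w0).
rewrite /dual_weight sum_nat_eq0 negb_forall => /existsP[i /=].
rewrite dimv_eq0 -vpick0; set u := vpick _ => u0.
have: u \in (orthTr sigma (U i) :&: rspace <[w]>)%VS by exact: memv_pick.
rewrite memv_cap mem_rspace => /andP[uU uw].
exists i => //; exists u => //; split=> //.
apply/esym/eqP; rewrite eqEdim !dim_vline w0 u0 leqnn andbT.
by rewrite -memvE.
Qed.
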